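(* Let $G$ and $H$ be graphs, and let $A\in\mathcal{S}(G)$ and $B\in\mathcal{S}(H)$ have the SSP. Suppose that $A$ and $B$ have exactly one distinct eigenvalue in common, $\operatorname{spec}(A)\cap\operatorname{spec}(B)=\{\lambda\}$, with $\operatorname{mult}_A(\lambda)=k$ and $\operatorname{mult}_B(\lambda)=\ell$, and that $\ker(A-\lambda I)$ and $\ker(B-\lambda I)$ are generic. Then for any $V_G\subseteq V(G)$ and $V_H\subseteq V(H)$ with - $|V_G|=k$ and $|V_H|=\ell+1$, or - $|V_G|=k+1$ and $|V_H|=\ell$, the set $$\beta=\{\{u,v\}: u\in V_G\text{ and }v\in V_H\}$$ is an SSP liberation set of $A\oplus B$ (viewed as a matrix in $\mathcal{S}(G\,\dot\cup\,H)$). In particular, there exists a matrix $C\in\mathcal{S}((G\,\dot\cup\,H)+\beta)$ with the SSP such that $\operatorname{spec}(C)=\operatorname{spec}(A)\cup\operatorname{spec}(B)$ (union as multisets).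
   Context: All graphs are finite and simple. For a graph $G$ on $n$ vertices, $\mathcal{S}(G)$ is the set of real symmetric $n\times n$ matrices (rows and columns indexed by $V(G)$) whose $(i,j)$-entry, $i\ne j$, is nonzero if and only if $\{i,j\}\in E(G)$; diagonal entries are unconstrained. $\overline{G}$ is the complement of $G$. For $\beta\subseteq E(\overline{G})$, $G+\beta$ is the graph with vertex set $V(G)$ and edge set $E(G)\cup\beta$. $G\,\dot\cup\,H$ is the disjoint union of graphs. $\mathcal{S}_0^{\rm cl}(G)$ is the set of real symmetric matrices with zero diagonal whose $(i,j)$-entry is nonzero only if $\{i,j\}\in E(G)$. $\operatorname{spec}(A)$ is the multiset of eigenvalues of $A$, and $\operatorname{mult}_A(\lambda)$ is the multiplicity of the eigenvalue $\lambda$. $[A,X]=AX-XA$, and $O$ is the zero matrix. For a spanning subgraph $G$ of $H$ and $A\in\mathcal{S}(G)$, $A$ has the SSP with respect to $H$ if $X=O$ is the only symmetric matrix with $X\in\mathcal{S}_0^{\rm cl}(\overline{H})$ and $[A,X]=O$. $A\in\mathcal{S}(G)$ has the SSP (strong spectral property) if it has it with respect to $G$ itself. A nonempty set $\beta\subseteq E(\overline{G})$ is an SSP liberation set of $A\in\mathcal{S}(G)$ if $A$ has the SSP with respect to $G+\beta'$ for all $\beta'\subset\beta$ with $|\beta'|=|\beta|-1$. A $d$-dimensional subspace $\mathcal{W}$ of $\mathbb{R}^n$ is generic if, for an $n\times d$ matrix $W$ whose columns form a basis of $\mathcal{W}$, every $d\times d$ submatrix of $W$ is invertible (this does not depend on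 the choice of $W$). *)

(* Defs.v *)
From HB Require Import structures.
From mathcomp Require Import all_boot all_order all_algebra.
From mathcomp Require Import reals.
Set Implicit Arguments.
Unset Strict Implicit.
Unset Printing Implicit Defensive.
Import GRing.Theory.
Local Open Scope ring_scope.

Record sgraph (T : finType) := SGraph {
  edges : {set {set T}};
  card_edge : forall e : {set T}, e \in edges -> #|e| = 2%N }.

Section Graphs.
Variable T : finType.
Implicit Types (G : sgraph T) (beta : {set {set T}}).

Fact compl_subproof G (e : {set T}) :
  e \in [set e : {set T} | #|e| == 2%N & e \notin edges G] -> #|e| = 2%N.
Proof. by rewrite inE => /andP[/eqP]. Qed.

Definition compl G : sgraph T := SGraph (@compl_subproof G).

Fact add_edges_subproof G beta (e : {set T}) :
  e \in edges G :|: (beta :&: edges (compl G)) -> #|e| = 2%N.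
Proof. by rewrite inE => /orP[|/setIP[_]]; apply: card_edge. Qed.

(* G + beta; the intersection makes the operation total, and changes nothing *)
(* when beta is a set of edges of the complement of G, as in all uses below. *)
Definition add_edges G beta : sgraph T := SGraph (@add_edges_subproof G beta).

End Graphs.

Fact dunion_subproof n m (G : sgraph 'I_n) (H : sgraph 'I_m)
    (e : {set 'I_(n + m)}) :
  e \in [set lshift m @: (f : {set 'I_n}) | f in edges G]
    :|: [set @rshift n m @: (f : {set 'I_m}) | f in edges H] -> #|e| = 2%N.
Proof.
case/setUP => /imsetP[f fE ->].
  by rewrite card_imset ?(card_edge fE) //; apply: lshift_inj.
by rewrite card_imset ?(card_edge fE) //; apply: rshift_inj.
Qed.

(* The vertices of G come first, so that the direct sum of A in S(G) and B   *)
(* in S(H) is block_mx A 0 0 B.                                              *)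
Definition dunion n m (G : sgraph 'I_n) (H : sgraph 'I_m) : sgraph 'I_(n + m) :=
  SGraph (@dunion_subproof n m G H).

Definition cross_edges n m (VG : {set 'I_n}) (VH : {set 'I_m}) :
    {set {set 'I_(n + m)}} :=
  [set [set lshift m u; rshift n v] | u in VG, v in VH].

Section Matrices.
Variables (R : realType) (n : nat).
Implicit Types (G : sgraph 'I_n) (A X : 'M[R]_n).

Definition in_S G A : Prop :=
  A^T = A /\ forall i j, i != j -> (A i j != 0) = ([set i; j] \in edges G).

Definition in_S0cl G X : Prop :=
  [/\ X^T = X, forall i, X i i = 0
    & forall i j, X i j != 0 -> [set i; j] \in edges G].

(* Only meant for A in S(G') with G' a spanning subgraph of G.               *)
Definition has_SSP_wrt G A : Prop :=
  forall X, in_S0cl (compl G) X -> A *m X - X *m A = 0 -> X = 0.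

Definition has_SSP G A : Prop := has_SSP_wrt G A.

Definition SSP_liberation_set G A (beta : {set {set 'I_n}}) : Prop :=
  [/\ in_S G A, beta != set0, beta \subset edges (compl G)
    & forall beta' : {set {set 'I_n}}, beta' \subset beta ->
        #|beta'| = (#|beta| - 1)%N -> has_SSP_wrt (add_edges G beta') A].

(* The spectrum as a multiset, i.e. the function giving the multiplicity of  *)
(* each real number (0 for a number that is not an eigenvalue).              *)
Definition spec A : R -> nat := fun x => mup x (char_poly A).

Definition ker A : {vspace 'cV[R]_n} :=
  lker (linfun (mulmx A : 'cV[R]_n -> 'cV[R]_n)).

Definition generic (W : {vspace 'cV[R]_n}) : Prop :=
  exists2 M : 'M[R]_(n, \dim W),
    basis_of W [seq col j M | j : 'I_(\dim W)]
  & forall f : 'I_(\dim W) -> 'I_n,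
      (forall i j : 'I_(\dim W), (i < j)%N -> (f i < f j)%N) ->
      rowsub f M \in unitmx.

End Matrices.

(* Main.v *)
Require Import Defs.
From HB Require Import structures.
From mathcomp Require Import all_boot all_order all_algebra.
From mathcomp Require Import reals complex ring lra.
From mathcomp Require boolp classical_sets topology normedtype derive realfun.
Set Implicit Arguments.
Unset Strict Implicit.
Unset Printing Implicit Defensive.
Import Order.TTheory GRing.Theory Num.Theory.
Local Open Scope ring_scope.

(** Why the theorem holds.

    Liberation.  Remove one edge from beta: the remaining set still contains
    all edges between two sets of k and l vertices.  Let X be a symmetric
    matrix as in the definition of the SSP, with off-diagonal block Y.  Its
    diagonal blocks vanish by the SSP of A and of B, and A Y = Y B.  In bases
    diagonalising A and B this equation says that only pairs of equal
    eigenvalues contribute to Y; as lambda is the only common one, the columns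
    of Y are in ker (A - lambda) and its rows in ker (B - lambda)
    (intertwiner_eigenspace).  A vector of a generic k-dimensional space that
    vanishes at k coordinates is zero (generic_eq0), so the zero k x l block of
    Y kills first k rows of Y, then each of its columns.

    Existence of C.  This part holds for the liberation set beta of any
    matrix (lemma liberation).  The entries of beta are made nonzero one at a
    time, by arbitrarily small moves within the orthogonal similarity class.
    The SSP with respect to G + beta', where beta' is beta without the edge e,
    says that the entries at the nonedges of G + beta and the entry at e can be
    prescribed freely near their present values
    (isospectral_prescription); so e can receive a nonzero value while the
    nonedges of G + beta keep a zero.  The nonzero entries and the SSP with
    respect to each G + (beta minus an edge) are open conditions
    (SSP_pattern_open), so a small move spoils nothing.

    Prescription of entries.  Rather than by the implicit function theorem, it
    is obtained by minimising over the compact orthogonal group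
        f Q = ||mxmask (Q^T A Q - T)|| + a ||Q - 1||,
    with mxmask the projection onto the prescribed positions, T the target and a
    small.  The penalty forces the minimiser to be near 1.  At a point
    B = Q^T A Q with defect r = mxmask (B - T) <> 0, rotating along the skew
    matrix K = [B, r] decreases the first term at the initial rate
    ||K|| / ||r|| per unit of ||U - 1||, U being the rotation, because
    <r, [B, [B, r]]> = ||K||^2.  The SSP makes ||K|| at least 2 a ||r||, so the
    decrease beats the penalty (isospectral_descent), and the minimiser has
    r = 0.  The rotations are Cayley transforms, for which the conjugate of B
    is an explicit expression in the resolvent of K. *)

(** * Spectra of real symmetric matrices and generic eigenspaces *)

(** The complex spectral theorem applies to the hermitian matrix A, with real
    eigenvalues; two real matrices similar over the complex numbers are similar
    over the reals, so that P can be taken real. *)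
Lemma real_symmetric_diagonalizable (R : rcfType) n (A : 'M[R]_n) :
  A^T = A ->
  exists P : 'M[R]_n, exists2 d : 'rV[R]_n,
    P \in unitmx & P *m A = diag_mx d *m P.
Proof.
move=> Asym.
pose toC : {rmorphism R -> R[i]} := real_complex R.
pose Ac := map_mx toC A.
have realC m p (M : 'M[R]_(m, p)) : map_mx toC M \is a mxOver Num.real.
  by apply/mxOverP => i j; rewrite mxE; apply/complex_realP; exists (M i j).
have liftC m p (M : 'M[R[i]]_(m, p)) : M \is a mxOver Num.real ->
    exists M0, M = map_mx toC M0.
  move=> /mxOverP Mr; exists (\matrix_(i, j) complex.Re (M i j)).
  by apply/matrixP => i j; rewrite !mxE; apply/esym/RRe_real.
have Aherm : Ac \is hermsymmx.
  apply: realsym_hermsym; last exact: realC.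
  by apply/is_hermitianmxP; rewrite scale1r map_mx_id // map_trmx Asym.
have Areal := hermitian_spectral_diag_real Aherm.
have [d dE] := liftC _ _ _ Areal.
have /orthomx_spectralP AE := hermitian_normalmx Aherm.
have sim : similar_in unitmx Ac (map_mx toC (diag_mx d)).
  exists (spectralmx Ac); first exact: spectral_unit.
  apply/similarP; first exact: spectral_unit.
  by rewrite {2}AE map_diag_mx -dE !mulmxA mulmxV ?spectral_unit ?mul1mx.
have [P] := real_similar sim (realC _ _ _) (realC _ _ _).
rewrite inE => /andP[/liftC[Q ->]]; rewrite map_unitmx => Qu /similarP.
rewrite map_unitmx => /(_ Qu); rewrite -!map_mxM => /map_mx_inj QA.
by exists Q, d.
Qed.

Section Similar.
Variables (F : fieldType) (n : nat).
Implicit Types A B P : 'M[F]_n.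

Lemma char_poly_similar A B P :
  P \in unitmx -> P *m A = B *m P -> char_poly A = char_poly B.
Proof.
move=> Pu PA.
have -> : A = invmx P *m B *m P by rewrite -mulmxA -PA mulKmx.
rewrite /char_poly /char_poly_mx.
have Pu' : map_mx polyC P \in unitmx by rewrite map_unitmx.
have -> : 'X%:M - map_mx polyC (invmx P *m B *m P)
    = invmx (map_mx polyC P) *m ('X%:M - map_mx polyC B) *m map_mx polyC P.
  rewrite mulmxBr mulmxBl !map_mxM map_invmx; congr (_ - _).
  by rewrite scalar_mxC -mulmxA mulVmx ?mulmx1.
by rewrite !det_mulmx mulrAC -det_mulmx mulVmx // det1 mul1r.
Qed.

Lemma char_poly_neq0 A : char_poly A != 0.
Proof. exact/monic_neq0/char_poly_monic. Qed.

End Similar.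

Lemma char_poly_dsum (F : fieldType) n m (A : 'M[F]_n) (B : 'M[F]_m) :
  char_poly (block_mx A 0 0 B) = char_poly A * char_poly B.
Proof.
rewrite /char_poly /char_poly_mx map_block_mx !map_mx0 scalar_mx_block.
by rewrite opp_block_mx add_block_mx !oppr0 !addr0 det_ublock.
Qed.

Section Spectrum.
Variable R : realType.

Lemma spec_dsum n m (A : 'M[R]_n) (B : 'M[R]_m) x :
  spec (block_mx A 0 0 B) x = (spec A x + spec B x)%N.
Proof. by rewrite /spec char_poly_dsum mupM ?char_poly_neq0. Qed.

Lemma spec_diagonalized n (A P : 'M[R]_n) d x :
  P \in unitmx -> P *m A = diag_mx d *m P ->
  spec A x = #|[pred i | d 0 i == x]|.
Proof.
move=> Pu PA; rewrite /spec (char_poly_similar Pu PA) char_poly_trig.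
  under eq_bigr do rewrite mxE eqxx mulr1n.
  rewrite -(big_map (fun i => d 0 i) xpredT (fun y => 'X - y%:P)).
  rewrite mu_prod_XsubC count_map cardE size_filter.
  by rewrite [index_enum _]unlock; apply: eq_count.
by apply/is_diag_mx_is_trig; apply: diag_mx_is_diag.
Qed.

Lemma memv_mxker n (A : 'M[R]_n) y : (y \in ker A) = (A *m y == 0).
Proof. by rewrite memv_ker lfunE. Qed.

(** The coordinates of index i with d_i = x in the diagonalising basis determine
    a vector of the eigenspace, all the others being zero. *)
Lemma dim_eigenspace_le n (A : 'M[R]_n) x :
  A^T = A -> (\dim (ker (A - x%:M)) <= spec A x)%N.
Proof.
move=> /real_symmetric_diagonalizable[P [d Pu PA]].
rewrite (spec_diagonalized _ Pu PA); set I := [pred i | _].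
pose L := linfun (rowsub (@enum_val _ I) \o mulmx P : 'cV[R]_n -> 'cV[R]_#|I|).
rewrite -(@limg_dim_eq _ _ _ L).
  apply: leq_trans (dimvS (subvf _)) _.
  by rewrite dimvf /dim /= muln1.
apply/eqP; rewrite -subv0; apply/subvP => y.
rewrite memv_cap memv_mxker memv_ker lfunE /= memv0 => /andP[/eqP yA /eqP yI].
suff /(congr1 (mulmx (invmx P))) : P *m y = 0 by rewrite mulKmx // mulmx0 => ->.
apply/matrixP => i j; rewrite [RHS]mxE ord1 {j}.
have [iI|iNI] := boolP (i \in I).
  have /matrixP/(_ (enum_rank_in iI i) 0) := yI.
  by rewrite mxE enum_rankK_in // [RHS]mxE.
have : (diag_mx d - x%:M) *m (P *m y) = 0.
  by rewrite mulmxA mulmxBl -PA -scalar_mxC -mulmxBr -mulmxA yA mulmx0.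
move/matrixP/(_ i 0); rewrite mulmxBl mul_diag_mx mul_scalar_mx !mxE -mulrBl.
move=> /eqP; rewrite mulf_eq0 subr_eq0.
by rewrite inE in iNI; rewrite (negPf iNI) => /eqP.
Qed.

(** With A and B diagonal, of eigenvalues d_i and e_j, the equation reads
    d_i Y_ij = Y_ij e_j: a nonzero Y_ij forces d_i = e_j, hence d_i = lambda. *)
Lemma intertwiner_eigenspace n m (A : 'M[R]_n) (B : 'M[R]_m) lambda
    (Y : 'M[R]_(n, m)) :
  A^T = A -> B^T = B ->
  (forall x, (0 < spec A x)%N -> (0 < spec B x)%N -> x = lambda) ->
  A *m Y = Y *m B -> (A - lambda%:M) *m Y = 0.
Proof.
move=> /real_symmetric_diagonalizable[P [d Pu PA]].
move=> /real_symmetric_diagonalizable[Q [e Qu QB]] common AY.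
pose Z := P *m Y *m invmx Q.
have ZE : diag_mx d *m Z = Z *m diag_mx e.
  rewrite /Z !mulmxA -PA -(mulmxA P A) AY mulmxA -!mulmxA; congr (_ *m (_ *m _)).
  by rewrite -[diag_mx e](mulmxK Qu) -QB !mulmxA mulVmx // mul1mx.
have Z0 : (diag_mx d - lambda%:M) *m Z = 0.
  apply/matrixP => i j; rewrite mulmxBl mul_diag_mx mul_scalar_mx !mxE -mulrBl.
  have /matrixP/(_ i j) := ZE; rewrite mul_diag_mx mul_mx_diag !mxE.
  move=> /eqP; rewrite mulrC -subr_eq0 -mulrBr mulf_eq0 subr_eq0.
  case/orP => [/eqP->|/eqP de]; first by rewrite mulr0.
  suff -> : d 0 i = lambda by rewrite subrr mul0r.
  apply: common.
    by rewrite (spec_diagonalized _ Pu PA); apply/card_gt0P; exists i; rewrite inE.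
  by rewrite (spec_diagonalized _ Qu QB) de; apply/card_gt0P; exists j; rewrite inE.
have : P *m ((A - lambda%:M) *m Y) = 0.
  rewrite mulmxA mulmxBr PA scalar_mxC -mulmxBl -mulmxA.
  by rewrite -[P *m Y](mulmxKV Qu) mulmxA Z0 mul0mx.
by move/(congr1 (mulmx (invmx P))); rewrite mulKmx // mulmx0.
Qed.

(** Writing y = M c for a basis M of W, the vanishing of y on V is a linear
    system in c whose matrix has, by genericity, an invertible square submatrix. *)
Lemma generic_eq0 n (W : {vspace 'cV[R]_n}) (V : {set 'I_n}) y :
  generic W -> (\dim W <= #|V|)%N -> y \in W ->
  (forall i, i \in V -> y i 0 = 0) -> y = 0.
Proof.
case=> M Mbasis Munit dimV yW y0.
pose f (i : 'I_(\dim W)) : 'I_n := enum_val (widen_ord dimV i).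
have fV i : f i \in V by exact: enum_valP.
have fmono (i j : 'I_(\dim W)) : (i < j)%N -> (f i < f j)%N.
  move=> ij.
  (* The enumeration of V is increasing, being part of 0, 1, ..., n - 1. *)
  have sV : sorted ltn (map val (enum V)).
    rewrite (_ : map val _ = filter (fun x => x \in map val (enum V)) (iota 0 n)).
      by apply: sorted_filter (iota_ltn_sorted _ _) => // ? ? ?; apply: ltn_trans.
    rewrite -val_enum_ord filter_map; congr map.
    rewrite {1}enumT /enum_mem; apply: eq_filter => x /=.
    by rewrite mem_map ?mem_enum //; apply: val_inj.
  have sz k : (k < \dim W)%N -> (k < size (enum V))%N.
    by move=> kd; rewrite -cardE (leq_trans kd).
  have vE (k : 'I_(\dim W)) : f k = nth 0%N (map val (enum V)) k :> nat.
    rewrite (nth_map (f k)) ?sz // /f /enum_val; congr (\val _).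
    by apply: set_nth_default; apply: sz => /=.
  by rewrite !vE (sorted_ltn_nth ltn_trans 0%N sV) // inE size_map sz.
have [c yE] : exists c, y = M *m c.
  have /subvP/(_ y yW) : (W <= limg (linfun (mulmx M : 'cV_(\dim W) -> _)))%VS.
    have /andP[/eqP spanM _] := Mbasis; rewrite -[X in (X <= _)%VS]spanM.
    apply/span_subvP => _ /imageP[j _ ->].
    apply/memv_imgP; exists (delta_mx j 0); rewrite ?memvf // lfunE /=.
    by rewrite colE.
  by case/memv_imgP => c _ ->; exists c; rewrite lfunE.
have : rowsub f M *m c = 0.
  rewrite mul_rowsub_mx -yE; apply/matrixP => i j.
  by rewrite !mxE ord1 y0 ?fV.
move/(congr1 (mulmx (invmx (rowsub f M)))).
by rewrite mulKmx ?Munit // mulmx0 yE => ->; rewrite mulmx0.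
Qed.

End Spectrum.

(** * The Frobenius inner product *)

Section Frobenius.
Variable R : rcfType.

Definition mxdot m n (X Y : 'M[R]_(m, n)) : R := \tr (X^T *m Y).
Definition fnorm m n (X : 'M[R]_(m, n)) : R := Num.sqrt (mxdot X X).

Section Rectangular.
Variables m n : nat.
Implicit Types (X Y Z : 'M[R]_(m, n)) (a : R).

Lemma mxdotE X Y : mxdot X Y = \sum_i \sum_j X i j * Y i j.
Proof.
rewrite exchange_big; apply: eq_bigr => j _.
by rewrite mxE; apply: eq_bigr => i _; rewrite mxE.
Qed.

Lemma mxdotC X Y : mxdot X Y = mxdot Y X.
Proof. by rewrite /mxdot -mxtrace_tr trmx_mul trmxK. Qed.

Lemma mxdotDl X Y Z : mxdot (X + Y) Z = mxdot X Z + mxdot Y Z.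
Proof. by rewrite /mxdot linearD mulmxDl linearD. Qed.

Lemma mxdotDr X Y Z : mxdot Z (X + Y) = mxdot Z X + mxdot Z Y.
Proof. by rewrite !(mxdotC Z) mxdotDl. Qed.

Lemma mxdotZl a X Y : mxdot (a *: X) Y = a * mxdot X Y.
Proof. by rewrite /mxdot linearZ -scalemxAl linearZ. Qed.

Lemma mxdotZr a X Y : mxdot X (a *: Y) = a * mxdot X Y.
Proof. by rewrite !(mxdotC X) mxdotZl. Qed.

Lemma mxdot_ge0 X : 0 <= mxdot X X.
Proof.
by rewrite mxdotE; do 2!apply: sumr_ge0 => ? _; rewrite -expr2 sqr_ge0.
Qed.

Lemma fnorm_ge0 X : 0 <= fnorm X. Proof. exact: sqrtr_ge0. Qed.

Lemma fnorm_sqr X : fnorm X ^+ 2 = mxdot X X.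
Proof. by rewrite sqr_sqrtr ?mxdot_ge0. Qed.

Lemma entry_le_fnorm X i j : `|X i j| <= fnorm X.
Proof.
rewrite -sqrtr_sqr ler_sqrt ?mxdot_ge0 // mxdotE (bigD1 i) //= (bigD1 j) //=.
rewrite -expr2 -addrA lerDl addr_ge0 //.
  by apply: sumr_ge0 => ? _; rewrite -expr2 sqr_ge0.
by do 2!apply: sumr_ge0 => ? _; rewrite -expr2 sqr_ge0.
Qed.

Lemma fnorm0 : fnorm (0 : 'M[R]_(m, n)) = 0.
Proof. by rewrite /fnorm /mxdot mulmx0 mxtrace0 sqrtr0. Qed.

Lemma fnorm_eq0 X : fnorm X = 0 -> X = 0.
Proof.
move=> X0; apply/matrixP => i j; apply/eqP; rewrite mxE -normr_eq0 eq_le.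
by rewrite normr_ge0 andbT -X0 entry_le_fnorm.
Qed.

(** Cauchy-Schwarz, from <Z, Z> >= 0 for Z = <Y, Y> X - <X, Y> Y. *)
Lemma mxdot_sqr_le X Y : mxdot X Y ^+ 2 <= mxdot X X * mxdot Y Y.
Proof.
have [Y0|Y0] := eqVneq (mxdot Y Y) 0.
  suff -> : Y = 0 by rewrite /mxdot !mulmx0 mxtrace0 mulr0 expr0n.
  by apply: fnorm_eq0; rewrite /fnorm Y0 sqrtr0.
have Yp : 0 < mxdot Y Y by rewrite lt_def Y0 mxdot_ge0.
have := mxdot_ge0 (mxdot Y Y *: X + (- mxdot X Y) *: Y).
rewrite !(mxdotDl, mxdotDr, mxdotZl, mxdotZr) (mxdotC Y X) => H.
rewrite -(ler_pM2l Yp); nra.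
Qed.

Lemma mxdot_le_fnorm X Y : mxdot X Y <= fnorm X * fnorm Y.
Proof.
apply: le_trans (ler_norm _) _; rewrite -sqrtr_sqr -sqrtrM ?mxdot_ge0 //.
by rewrite ler_sqrt ?mxdot_sqr_le // mulr_ge0 ?mxdot_ge0.
Qed.

Lemma fnormD X Y : fnorm (X + Y) <= fnorm X + fnorm Y.
Proof.
rewrite -ler_sqr ?nnegrE ?addr_ge0 ?fnorm_ge0 // sqrrD !fnorm_sqr.
rewrite mxdotDl !mxdotDr (mxdotC Y X).
by have := mxdot_le_fnorm X Y; lra.
Qed.

Lemma fnormZ a X : fnorm (a *: X) = `|a| * fnorm X.
Proof.
by rewrite /fnorm mxdotZl mxdotZr mulrA -expr2 sqrtrM ?sqr_ge0 // sqrtr_sqr.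
Qed.

Lemma fnormN X : fnorm (- X) = fnorm X.
Proof. by rewrite -scaleN1r fnormZ normrN1 mul1r. Qed.

Lemma fnormB X Y : fnorm (X - Y) <= fnorm X + fnorm Y.
Proof. by rewrite -(fnormN Y) fnormD. Qed.

End Rectangular.

Lemma fnorm_tr m n (X : 'M[R]_(m, n)) : fnorm X^T = fnorm X.
Proof. by rewrite /fnorm /mxdot trmxK mxtrace_mulC. Qed.

Lemma fnorm_mxvec m n (X : 'M[R]_(m, n)) : fnorm (mxvec X) = fnorm X.
Proof.
congr Num.sqrt; rewrite !mxdotE big_ord1 pair_big /=.
rewrite (reindex (uncurry (@mxvec_index m n))) /=.
  by apply: eq_bigr => -[i j] _; rewrite mxvecE.
exact: curry_mxvec_bij.
Qed.

Lemma fnormM m n p (X : 'M[R]_(m, n)) (Y : 'M[R]_(n, p)) :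
  fnorm (X *m Y) <= fnorm X * fnorm Y.
Proof.
rewrite -sqrtrM ?mxdot_ge0 // ler_sqrt ?mulr_ge0 ?mxdot_ge0 //.
have -> : mxdot Y Y = mxdot Y^T Y^T by rewrite /mxdot trmxK mxtrace_mulC.
rewrite !mxdotE mulr_suml ler_sum // => i _; rewrite mulr_sumr ler_sum // => j _.
have := mxdot_sqr_le (row i X) (row j Y^T).
rewrite !mxdotE !big_ord1 expr2; congr (_ * _ <= _ * _).
- by rewrite mxE; apply: eq_bigr => k _; rewrite !mxE.
- by rewrite mxE; apply: eq_bigr => k _; rewrite !mxE.
- by apply: eq_bigr => k _; rewrite !mxE.
- by apply: eq_bigr => k _; rewrite !mxE.
Qed.

Lemma fnorm_unitaryl m n (Q : 'M[R]_m) (X : 'M[R]_(m, n)) :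
  Q^T *m Q = 1%:M -> fnorm (Q *m X) = fnorm X.
Proof.
by move=> Q1; rewrite /fnorm /mxdot trmx_mul -mulmxA (mulmxA _ Q) Q1 mul1mx.
Qed.

Lemma fnorm_unitaryr m n (Q : 'M[R]_n) (X : 'M[R]_(m, n)) :
  Q^T *m Q = 1%:M -> fnorm (X *m Q) = fnorm X.
Proof.
move=> /mulmx1C Q1; rewrite -fnorm_tr trmx_mul fnorm_unitaryl ?fnorm_tr //.
by rewrite trmxK.
Qed.

Lemma fnorm_row_mx m n p (X : 'M[R]_(m, n)) :
  fnorm (row_mx X (0 : 'M_(m, p))) = fnorm X.
Proof.
rewrite /fnorm !mxdotE; congr Num.sqrt; apply: eq_bigr => i _.
rewrite big_split_ord /= [X in _ + X]big1 ?addr0 => [|j _].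
  by apply: eq_bigr => j _; rewrite row_mxEl.
by rewrite row_mxEr mxE mulr0.
Qed.

End Frobenius.

(** * A quantitative form of the strong spectral property *)

Section QuantitativeSSP.
Variables (R : rcfType) (n : nat).
Implicit Types (A X : 'M[R]_n) (N : rel 'I_n).

Definition comm A X : 'M[R]_n := A *m X - X *m A.

Lemma fnorm_comm A X : fnorm (comm A X) <= 2 * fnorm A * fnorm X.
Proof.
apply: le_trans (fnormB _ _) _.
have := fnormM A X; have := fnormM X A; lra.
Qed.

Lemma commBl A A' X : comm (A - A') X = comm A X - comm A' X.
Proof.
rewrite /comm mulmxBl mulmxBr !opprB addrACA [RHS]addrACA.
by congr (_ + _); exact: addrC.
Qed.

(** The projection onto the matrices supported on the positions in N; for N the
    nonedges of a graph, the matrices X tested by the SSP are the symmetric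
    fixed points. *)
Definition mxmask N X := \matrix_(i, j) (if N i j then X i j else 0).

Lemma mxmask_is_linear N : linear (mxmask N).
Proof.
by move=> a X Y; apply/matrixP => i j; rewrite !mxE; case: ifP; rewrite ?mulr0 ?addr0.
Qed.
HB.instance Definition _ N :=
  GRing.isLinear.Build R 'M[R]_n 'M[R]_n _ (mxmask N) (mxmask_is_linear N).

Lemma mxmaskK N X : mxmask N (mxmask N X) = mxmask N X.
Proof. by apply/matrixP => i j; rewrite !mxE; case: (N i j). Qed.

Lemma mxmask_tr N X : symmetric N -> (mxmask N X)^T = mxmask N X^T.
Proof. by move=> Nsym; apply/matrixP => i j; rewrite !mxE Nsym. Qed.

Lemma mxdot_mxmask N X Y : mxmask N X = X -> mxdot X (mxmask N Y) = mxdot X Y.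
Proof.
move=> <-; rewrite !mxdotE; apply: eq_bigr => i _; apply: eq_bigr => j _.
by rewrite !mxE; case: ifP; rewrite ?mul0r.
Qed.

Lemma fnorm_mxmask N X : fnorm (mxmask N X) <= fnorm X.
Proof.
rewrite ler_sqrt ?mxdot_ge0 // !mxdotE; apply: ler_sum => i _.
by apply: ler_sum => j _; rewrite !mxE; case: ifP; rewrite // mul0r -expr2 sqr_ge0.
Qed.

(** For N the nonedges of a graph, this is the SSP with respect to that graph. *)
Definition SSP_pattern N A := forall X,
  X^T = X -> mxmask N X = X -> comm A X = 0 -> X = 0.

(** A quantitative SSP.  The map sending X to ([A, X], X - X^T, X - mxmask X) is
    linear and injective, so it has a linear left inverse, and 1 / c can be any
    positive bound on the norm of this inverse; the last two components vanish on the X at hand. *)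
Lemma SSP_pattern_lower_bound N A : SSP_pattern N A ->
  exists2 c, 0 < c & forall X, X^T = X -> mxmask N X = X ->
    c * fnorm X <= fnorm (comm A X).
Proof.
move=> sA.
pose h1 := lin_mx (mulmx A \- mulmxr A : 'M[R]_n -> 'M[R]_n).
pose h2 := lin_mx (idfun \- trmx : 'M[R]_n -> 'M[R]_n).
pose h3 := lin_mx (idfun \- mxmask N : 'M[R]_n -> 'M[R]_n).
pose h := row_mx h1 (row_mx h2 h3).
have hE X : mxvec X *m h
    = row_mx (mxvec (comm A X)) (row_mx (mxvec (X - X^T)) (mxvec (X - mxmask N X))).
  by rewrite /h !mul_mx_row !mul_vec_lin.
have /row_freeP[B hB] : row_free h.
  apply: inj_row_free => v; rewrite -[v]vec_mxK hE => /eqP.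
  rewrite !row_mx_eq0 !mxvec_eq0 !subr_eq0 => /and3P[c0 /eqP sym /eqP msk].
  by rewrite (sA (vec_mx v)) ?linear0 //; apply/eqP; rewrite subr_eq0.
exists (1 + fnorm B)^-1 => [|X Xsym Xmask].
  by rewrite invr_gt0 ltr_pwDl ?fnorm_ge0.
rewrite mulrC ler_pdivrMr ?ltr_pwDl ?fnorm_ge0 //.
rewrite -fnorm_mxvec -[mxvec X]mulmx1 -hB mulmxA hE Xmask Xsym !subrr.
rewrite linear0 row_mx0; apply: le_trans (fnormM _ _) _.
rewrite fnorm_row_mx fnorm_mxvec ler_wpM2l ?fnorm_ge0 // lerDr.
exact: ler01.
Qed.

Lemma lower_bound_near N A c A' :
  (forall X, X^T = X -> mxmask N X = X -> c * fnorm X <= fnorm (comm A X)) ->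
  fnorm (A' - A) <= c / 4 ->
  forall X, X^T = X -> mxmask N X = X -> c / 2 * fnorm X <= fnorm (comm A' X).
Proof.
move=> lb A'A X Xsym Xmask.
have := lb X Xsym Xmask; have := fnorm_ge0 X.
have := fnorm_comm (A' - A) X; rewrite commBl.
have := fnormB (comm A' X) (comm A' X - comm A X).
rewrite opprB addrC subrK; nra.
Qed.

(** The SSP survives small perturbations because its quantitative form does. *)
Lemma SSP_pattern_open N A : SSP_pattern N A ->
  exists2 e, 0 < e & forall A', fnorm (A' - A) < e -> SSP_pattern N A'.
Proof.
move=> /SSP_pattern_lower_bound[c c0 lb]; exists (c / 4).
  by rewrite divr_gt0.
move=> A' A'A X Xsym Xmask X0; apply: fnorm_eq0; apply/eqP.
have := lower_bound_near lb (ltW A'A) Xsym Xmask; rewrite X0 fnorm0.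
have := fnorm_ge0 X; rewrite eq_le => ->; rewrite andbT; nra.
Qed.

End QuantitativeSSP.

(** * Minimisation over the orthogonal group *)

Section Continuity.
Import boolp classical_sets topology normedtype derive realfun.
Import numFieldNormedType.Exports.
Variables (R : realType) (T : topologicalType).

(** Continuity entry by entry, which avoids relating the Frobenius norm to the
    topology of spaces of matrices. *)
Definition mx_continuous m n (F : T -> 'M[R]_(m, n)) :=
  forall i j, continuous (fun x => F x i j).

Lemma continuous_sumr (I : Type) (r : seq I) (f : I -> T -> R) :
  (forall i, continuous (f i)) -> continuous (fun x => \sum_(i <- r) f i x).
Proof.
move=> fc; elim: r => [|i r IH] x.
  by under eq_fun do rewrite big_nil; apply: cvg_cst.
under eq_fun do rewrite big_cons.
by apply: cvgD; [apply: fc|apply: IH].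
Qed.

Lemma mx_continuous_cst m n (A : 'M[R]_(m, n)) : mx_continuous (fun=> A).
Proof. by move=> i j x; apply: cvg_cst. Qed.

Lemma mx_continuousB m n (F G : T -> 'M[R]_(m, n)) :
  mx_continuous F -> mx_continuous G -> mx_continuous (fun x => F x - G x).
Proof.
move=> Fc Gc i j; under eq_fun do rewrite !mxE.
by move=> x; apply: cvgB; [apply: Fc|apply: Gc].
Qed.

Lemma mx_continuousM m n p (F : T -> 'M[R]_(m, n)) (G : T -> 'M[R]_(n, p)) :
  mx_continuous F -> mx_continuous G -> mx_continuous (fun x => F x *m G x).
Proof.
move=> Fc Gc i j; under eq_fun do rewrite mxE.
by apply: continuous_sumr => k x; apply: cvgM; [apply: Fc|apply: Gc].
Qed.

Lemma mx_continuous_tr m n (F : T -> 'M[R]_(m, n)) :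
  mx_continuous F -> mx_continuous (fun x => (F x)^T).
Proof. by move=> Fc i j; under eq_fun do rewrite mxE; apply: Fc. Qed.

Lemma mx_continuous_mxmask n N (F : T -> 'M[R]_n) :
  mx_continuous F -> mx_continuous (fun x => mxmask N (F x)).
Proof.
move=> Fc i j; under eq_fun do rewrite mxE.
by case: (N i j); [apply: Fc|move=> x; apply: cvg_cst].
Qed.

Lemma continuous_fnorm m n (F : T -> 'M[R]_(m, n)) :
  mx_continuous F -> continuous (fun x => fnorm (F x)).
Proof.
move=> Fc x.
have dotc : continuous (fun x => mxdot (F x) (F x)).
  under eq_fun do rewrite mxdotE.
  by do 2!apply: continuous_sumr => ?; move=> y; apply: cvgM; apply: Fc.
apply: (@continuous_comp _ _ _ (fun x => mxdot (F x) (F x)) Num.sqrt); last first.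
  exact: sqrt_continuous.
exact: dotc.
Qed.

Lemma continuous_penalty (f g : T -> R) a :
  continuous f -> continuous g -> continuous (fun x => f x + a * g x).
Proof.
move=> fc gc x; apply: cvgD; first exact: fc.
by apply: cvgM; [exact: cvg_cst|exact: gc].
Qed.

End Continuity.

Section OrthogonalMinimum.
Import boolp classical_sets topology normedtype derive realfun.
Import numFieldNormedType.Exports.
Variable R : realType.

Lemma mx_continuous_vec_mx m n :
  mx_continuous (@vec_mx R m n).
Proof. by move=> i j; under eq_fun do rewrite mxE; apply: coord_continuous. Qed.

(** The orthogonal group is closed, and bounded since its elements all have the
    Frobenius norm of the identity.  It is transported to row vectors, where
    closed bounded sets are compact. *)
Lemma orthogonal_min n (f : 'M[R]_n -> R) :
  continuous (f \o vec_mx : 'rV[R]_(n * n) -> R) ->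
  exists2 Q : 'M[R]_n, Q^T *m Q = 1%:M
    & forall U : 'M[R]_n, U^T *m U = 1%:M -> f Q <= f U.
Proof.
move=> fc; pose O := [set v : 'rV[R]_(n * n) | (vec_mx v)^T *m vec_mx v = 1%:M]%classic.
have OE (U : 'M[R]_n) : U^T *m U = 1%:M -> (mxvec U \in O)%classic.
  by move=> U1; apply/mem_set; rewrite /O /= mxvecK.
have O1 : (O !=set0)%classic.
  by exists (mxvec 1%:M); rewrite /O /= mxvecK trmx1 mulmx1.
have Oclosed : closed O.
  pose F (v : 'rV[R]_(n * n)) : 'M[R]_n := (vec_mx v)^T *m vec_mx v.
  have Fc : mx_continuous F.
    apply: mx_continuousM; last exact: mx_continuous_vec_mx.
    exact/mx_continuous_tr/mx_continuous_vec_mx.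
  rewrite (_ : O = \bigcap_(ij in [set: 'I_n * 'I_n])
      ((fun v => F v ij.1 ij.2) @^-1` [set x | x = (1%:M : 'M[R]_n) ij.1 ij.2]))%classic.
    apply: closed_bigI => -[i j] _; apply: closed_comp; last exact: closed_eq.
    by move=> v _; apply: Fc.
  apply/seteqP; split => v /=; first by move=> Ov [i j] _ /=; rewrite /F Ov.
  by move=> Fv; apply/matrixP => i j; apply: (Fv (i, j)).
have Obounded : bounded_set O.
  exists (fnorm (1%:M : 'M[R]_n)); split; first exact: num_real.
  move=> M ltM v Ov; apply: le_trans (ltW ltM).
  have -> : fnorm (1%:M : 'M[R]_n) = fnorm v.
    rewrite -[v]vec_mxK fnorm_mxvec -[in RHS](mulmx1 (vec_mx v)).
    by rewrite fnorm_unitaryl.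
  rewrite [leLHS]/Num.norm /= mx_normrE.
  by apply/bigmax_leP; split => [|[i j] _]; [exact: fnorm_ge0|exact: entry_le_fnorm].
have [v Ov vmin] := EVT_min_rV O1 (bounded_closed_compact Obounded Oclosed)
  (continuous_subspaceT fc).
exists (vec_mx v) => [|U U1]; first exact: (set_mem Ov).
by have := vmin _ (OE _ U1); rewrite /= mxvecK.
Qed.

End OrthogonalMinimum.

(** * Cayley transforms *)

Section Cayley.
Variables (R : rcfType) (n : nat) (K : 'M[R]_n).
Hypothesis Kskew : K^T = - K.
Implicit Types (s : R) (X A : 'M[R]_n).

Let E s : 'M[R]_n := 1%:M + s *: K.

Lemma mxdot_skew m (X : 'M[R]_(n, m)) : mxdot X (K *m X) = 0.
Proof.
apply/eqP; rewrite -[_ == 0](mulrn_eq0 _ 2) /= mulr2n {1}mxdotC.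
by rewrite /mxdot trmx_mul Kskew mulmxN mulNmx mulmxA linearN /= addNr.
Qed.

Let trE s : (E s)^T = 1%:M - s *: K.
Proof. by rewrite /E linearD linearZ /= trmx1 Kskew scalerN. Qed.

(** For K skew, K X is orthogonal to X, so ||X + s K X||^2 = ||X||^2 + s^2
    ||K X||^2.  Hence 1 + s K is invertible and its inverse is a contraction. *)
Lemma fnorm_one_plus_skew s m (X : 'M[R]_(n, m)) : fnorm X <= fnorm (E s *m X).
Proof.
rewrite ler_sqrt ?mxdot_ge0 // /E mulmxDl mul1mx -scalemxAl.
rewrite !(mxdotDl, mxdotDr, mxdotZl, mxdotZr) (mxdotC (K *m X)) mxdot_skew.
by have := mxdot_ge0 (K *m X); nra.
Qed.

Lemma one_plus_skew_unit s : E s \in unitmx.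
Proof.
rewrite -unitmx_tr -row_free_unit; apply: inj_row_free => v /(congr1 trmx).
rewrite trmx_mul trmxK trmx0 => Ev; apply: trmx_inj; rewrite trmx0.
apply/fnorm_eq0/eqP; rewrite eq_le fnorm_ge0 andbT -(fnorm0 R n 1) -Ev.
exact: fnorm_one_plus_skew.
Qed.

Definition resolvent s : 'M[R]_n := invmx (E s).

(** The Cayley transform (1 - s K) (1 + s K)^-1, written so as to be affine in
    the resolvent. *)
Definition cayley s : 'M[R]_n := 2 *: resolvent s - 1%:M.

Lemma resolventl s : E s *m resolvent s = 1%:M.
Proof. by rewrite mulmxV ?one_plus_skew_unit. Qed.

Lemma resolventr s : resolvent s *m E s = 1%:M.
Proof. by rewrite mulVmx ?one_plus_skew_unit. Qed.

Lemma resolventE s : resolvent s = 1%:M - s *: (K *m resolvent s).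
Proof.
by rewrite -[in 1%:M](resolventl s) /E mulmxDl mul1mx -scalemxAl addrK.
Qed.

Lemma resolvent_comm s : K *m resolvent s = resolvent s *m K.
Proof.
have : K *m E s = E s *m K.
  by rewrite /E mulmxDl mulmxDr mul1mx mulmx1 -scalemxAl -scalemxAr.
move/(congr1 (fun X => resolvent s *m X *m resolvent s)).
by rewrite !mulmxA resolventr mul1mx -!mulmxA resolventl mulmx1.
Qed.

Lemma fnorm_resolventl s m (X : 'M[R]_(n, m)) :
  fnorm (resolvent s *m X) <= fnorm X.
Proof.
by apply: le_trans (fnorm_one_plus_skew s _) _; rewrite mulmxA resolventl mul1mx.
Qed.

Lemma tr_cayley s : (cayley s)^T = 2 *: (resolvent s)^T - 1%:M.
Proof. by rewrite /cayley linearB linearZ /= trmx1. Qed.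

Lemma cayley_orthogonal s : (cayley s)^T *m cayley s = 1%:M.
Proof.
set V := resolvent s.
have V1 : V^T *m (E s)^T = 1%:M by rewrite -trmx_mul resolventl trmx1.
have VD : V + V^T = 2 *: (V^T *m V).
  rewrite -{1}[V]mul1mx -V1 -{2}[V^T]mulmx1 -(resolventl s) mulmxA -mulmxDl.
  rewrite -mulmxDr trE /E addrACA addNr addr0 -mulr2n -scaler_nat.
  by rewrite -scalemxAr mulmx1 -scalemxAl.
rewrite tr_cayley /cayley -/V mulmxBl !mulmxBr !mul1mx mulmx1.
rewrite -scalemxAl -scalemxAr -VD.
by apply/matrixP => i j; rewrite !mxE; ring.
Qed.

(** An exact formula instead of a first-order expansion: as the resolvent tends
    to 1 with s, it exhibits the derivative -2 [A, K] together with a controlled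
    remainder. *)
Lemma cayley_conj s A :
  (cayley s)^T *m A *m cayley s - A
  = - (2 * s) *: ((resolvent s)^T *m comm A K *m resolvent s).
Proof.
set V := resolvent s.
have V1 : V^T *m (E s)^T = 1%:M by rewrite -trmx_mul resolventl trmx1.
have AV : A *m V = V^T *m (A - s *: (K *m A)) *m V.
  rewrite -{1}[A]mul1mx -V1 trE -(mulmxA V^T) mulmxBl.
  by rewrite mul1mx -scalemxAl.
have VA : V^T *m A = V^T *m (A + s *: (A *m K)) *m V.
  rewrite -{1}[A]mulmx1 -(resolventl s) /E !mulmxA -/V; congr (_ *m V).
  by rewrite -mulmxA mulmxDr mulmx1 -scalemxAr.
rewrite tr_cayley /cayley -/V !(mulmxBl, mulmxBr) !mul1mx !mulmx1.
rewrite -?(scalemxAl, scalemxAr); set W := V^T *m A *m V.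
rewrite {}AV {}VA /comm !(mulmxBl, mulmxBr, mulmxDl, mulmxDr).
rewrite -?(scalemxAl, scalemxAr) !mulmxA -/W.
move: W (V^T *m A *m K *m V) (V^T *m K *m A *m V) => X Y Z.
by apply/matrixP => i j; rewrite !mxE; ring.
Qed.

End Cayley.

Section CayleyBounds.
Variables (R : rcfType) (n : nat) (K : 'M[R]_n).
Hypothesis Kskew : K^T = - K.
Implicit Types (s : R) (X : 'M[R]_n).

Lemma resolvent_tr s : (resolvent K s)^T = resolvent K (- s).
Proof.
by rewrite /resolvent trmx_inv linearD linearZ /= trmx1 Kskew scalerN scaleNr.
Qed.

Lemma fnorm_resolvent_conj s X :
  fnorm ((resolvent K s)^T *m X *m resolvent K s) <= fnorm X.
Proof.
rewrite -fnorm_tr trmx_mul resolvent_tr; apply: le_trans (fnorm_resolventl _ _ _) _ => //.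
by rewrite fnorm_tr; apply: fnorm_resolventl.
Qed.

Lemma fnorm_resolvent_sub1 s :
  0 <= s -> fnorm (resolvent K s - 1%:M) <= s * fnorm K.
Proof.
move=> s0; rewrite {1}(resolventE Kskew) addrC addKr fnormN fnormZ ger0_norm //.
by rewrite ler_wpM2l // (resolvent_comm Kskew) fnorm_resolventl.
Qed.

Lemma fnorm_cayley_sub1 s :
  0 <= s -> fnorm (cayley K s - 1%:M) <= 2 * s * fnorm K.
Proof.
move=> s0; have -> : cayley K s - 1%:M = 2 *: (resolvent K s - 1%:M).
  by apply/matrixP => i j; rewrite !mxE; ring.
rewrite fnormZ normr_nat -mulrA ler_wpM2l //; exact: fnorm_resolvent_sub1.
Qed.

Lemma fnorm_resolvent_conj_sub s X : 0 <= s ->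
  fnorm ((resolvent K s)^T *m X *m resolvent K s - X)
    <= 2 * s * fnorm K * fnorm X.
Proof.
move=> s0; set V := resolvent K s.
have -> : V^T *m X *m V - X = (V - 1%:M)^T *m (X *m V) + X *m (V - 1%:M).
  by rewrite linearB /= trmx1 mulmxBl mul1mx mulmxBr mulmx1 mulmxA addrA subrK.
have V1 := fnorm_resolvent_sub1 s0; rewrite -/V in V1.
have XV : fnorm (X *m V) <= fnorm X.
  by rewrite -fnorm_tr trmx_mul resolvent_tr -[leRHS]fnorm_tr fnorm_resolventl.
apply: le_trans (fnormD _ _) _.
have := fnormM (V - 1%:M)^T (X *m V); rewrite fnorm_tr.
have := fnormM X (V - 1%:M).
have := fnorm_ge0 X; have := fnorm_ge0 (X *m V); have := fnorm_ge0 (V - 1%:M).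
nra.
Qed.

End CayleyBounds.

(** * Prescribing entries within a similarity class *)

Section Descent.
Variables (R : rcfType) (n : nat) (N : rel 'I_n) (A T : 'M[R]_n) (a : R).
Hypotheses (Nsym : symmetric N) (Asym : A^T = A) (Tsym : T^T = T) (a0 : 0 < a).
Let r := mxmask N (A - T).
Hypotheses (r0 : r != 0) (slope : 2 * a * fnorm r <= fnorm (comm A r)).

(** Rotating by the Cayley transform of K = [A, r] with parameter s changes
    ||r||^2 by at most -4 s ||K||^2 + s^2 L, and costs at most 2 a s ||K|| in
    the penalty.  Since ||K|| >= 2 a ||r||, the gain wins for small s. *)
Lemma isospectral_descent : exists2 U : 'M[R]_n, U^T *m U = 1%:M
  & fnorm (mxmask N (U^T *m A *m U - T)) + a * fnorm (U - 1%:M) < fnorm r.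
Proof.
have rsym : r^T = r by rewrite /r mxmask_tr // linearB /= Asym Tsym.
have rmask : mxmask N r = r by rewrite /r mxmaskK.
have slopeK := slope; set K := comm A r in slopeK.
have Kskew : K^T = - K.
  by rewrite /K /comm linearB /= !trmx_mul Asym rsym opprB.
set D := comm A K.
have rD : mxdot r D = fnorm K ^+ 2.
  rewrite fnorm_sqr /mxdot rsym Kskew /D /comm mulmxBr linearB /= !mulmxA.
  rewrite (mxtrace_mulC (r *m K)) mulmxA -linearB /= -mulmxBl.
  by rewrite -[r *m A - _]opprB.
have rp : 0 < fnorm r.
  by rewrite lt_def fnorm_ge0 andbT; apply: contra_neq r0 => /fnorm_eq0.
have kp : 0 < fnorm K by have := mulr_gt0 a0 rp; lra.
(* L bounds the second-order terms of ||r||^2 along the rotation.  In s, the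
   first bound makes s L at most ||K||^2; the second one keeps
   ||r|| - 2 a s ||K|| positive, so that norms can be compared by squares. *)
set L := 8 * fnorm r * fnorm K * fnorm D + 4 * fnorm D ^+ 2.
have L0 : 0 <= L by rewrite addr_ge0 ?mulr_ge0 ?fnorm_ge0.
pose s := Num.min (fnorm K ^+ 2 / (L + 1)) (fnorm r / (4 * a * fnorm K)).
have sp : 0 < s.
  rewrite lt_min !divr_gt0 ?mulr_gt0 ?exprn_gt0 //; first lra.
have sL : s * L <= fnorm K ^+ 2.
  apply: le_trans (_ : s * (L + 1) <= _); first by rewrite ler_pM2l // lerDl.
  by rewrite -ler_pdivlMr ?ge_min ?lexx //; lra.
have sr : s * (4 * a * fnorm K) <= fnorm r.
  by rewrite -ler_pdivlMr ?ge_min ?lexx ?orbT // !mulr_gt0.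
exists (cayley K s); first exact: cayley_orthogonal.
set U := cayley K s; set V := resolvent K s.
have -> : mxmask N (U^T *m A *m U - T)
    = r - (2 * s) *: mxmask N (V^T *m D *m V).
  rewrite -[U^T *m A *m U](subrK A) (cayley_conj Kskew) -addrA.
  by rewrite linearD linearZ /= scaleNr [LHS]addrC.
set W := V^T *m D *m V.
have WD : fnorm (mxmask N W) <= fnorm D.
  by apply: le_trans (fnorm_mxmask _ _) _; apply: fnorm_resolvent_conj.
have rW : fnorm K ^+ 2 - 2 * s * fnorm K * fnorm D * fnorm r <= mxdot r W.
  have -> : W = D - (D - W) by rewrite opprB addrC subrK.
  rewrite mxdotDr -(scaleN1r (D - W)) mxdotZr rD.
  have := mxdot_le_fnorm r (D - W).
  have : fnorm (D - W) <= 2 * s * fnorm K * fnorm D.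
    by rewrite -fnormN opprB; apply: fnorm_resolvent_conj_sub => //; apply: ltW.
  nra.
have U1 : fnorm (U - 1%:M) <= 2 * s * fnorm K.
  by apply: fnorm_cayley_sub1 => //; apply: ltW.
have aU : a * fnorm (U - 1%:M) <= 2 * a * s * fnorm K by have := ler_wpM2l (ltW a0) U1; lra.
have sq : fnorm (r - (2 * s) *: mxmask N W) ^+ 2
    <= fnorm r ^+ 2 - 4 * s * fnorm K ^+ 2 + s ^+ 2 * L.
  rewrite fnorm_sqr -scaleNr !(mxdotDl, mxdotDr, mxdotZl, mxdotZr).
  rewrite (mxdotC _ r) mxdot_mxmask // -!fnorm_sqr /L.
  have W2 : fnorm (mxmask N W) ^+ 2 <= fnorm D ^+ 2.
    by rewrite ler_sqr ?nnegrE ?fnorm_ge0.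
  have := ler_wpM2l (ltW sp) rW; have := ler_wpM2l (sqr_ge0 s) W2; lra.
rewrite -ltrBrDr.
apply: lt_le_trans (_ : fnorm r - 2 * a * s * fnorm K <= _); last lra.
rewrite -ltr_sqr ?nnegrE ?fnorm_ge0 //; last by lra.
apply: le_lt_trans sq _.
have := ler_wpM2l (ltW sp) sL.
have := ler_wpM2l (mulr_ge0 (ltW sp) (ltW kp)) slopeK.
have := mulr_gt0 sp (exprn_gt0 2 kp).
have := sqr_ge0 (a * s * fnorm K).
lra.
Qed.

End Descent.

Section Perturbation.
Import boolp classical_sets topology normedtype derive realfun.
Import numFieldNormedType.Exports.
Variables (R : realType) (n : nat) (N : rel 'I_n).
Hypothesis Nsym : symmetric N.

(** The penalised distance to T is minimised over the orthogonal group.  Its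
    value at 1 is small, which bounds the penalty and keeps the minimiser close
    to 1; there the quantitative SSP still holds with half the constant, so a
    nonzero defect would contradict isospectral_descent.  The weight a = c / 4
    leaves half of that constant, c / 2 = 2 a. *)
Lemma isospectral_prescription (A : 'M[R]_n) (e : R) :
  A^T = A -> SSP_pattern N A -> 0 < e ->
  exists2 d : R, 0 < d & forall T : 'M[R]_n, T^T = T -> fnorm (T - A) < d ->
    exists2 Q : 'M[R]_n, Q^T *m Q = 1%:M
      & fnorm (Q^T *m A *m Q - A) < e /\ mxmask N (Q^T *m A *m Q) = mxmask N T.
Proof.
move=> Asym /SSP_pattern_lower_bound[c c0 lb] e0; pose a := c / 4.
have a0 : 0 < a by rewrite divr_gt0.
pose e' := Num.min e a.
have e'0 : 0 < e' by rewrite lt_min e0.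
have M0 : 0 < 2 * fnorm A + 1 by rewrite ltr_wpDl ?mulr_ge0 ?fnorm_ge0.
exists (a * e' / (2 * fnorm A + 1)) => [|T Tsym TA].
  by apply: divr_gt0 => //; apply: mulr_gt0.
pose f (Q : 'M[R]_n) :=
  fnorm (mxmask N (Q^T *m A *m Q - T)) + a * fnorm (Q - 1%:M).
have fc : continuous (f \o vec_mx : 'rV[R]_(n * n) -> R).
  have vc := @mx_continuous_vec_mx R n n.
  have fc1 : continuous (fun v : 'rV[R]_(n * n) =>
      fnorm (mxmask N ((vec_mx v)^T *m A *m vec_mx v - T))).
    apply: continuous_fnorm; apply: mx_continuous_mxmask.
    apply: mx_continuousB; last exact: mx_continuous_cst.
    apply: mx_continuousM => //; apply: mx_continuousM; last exact: mx_continuous_cst.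
    exact: mx_continuous_tr.
  have fc2 : continuous (fun v : 'rV[R]_(n * n) => fnorm (vec_mx v - 1%:M : 'M[R]_n)).
    by apply: continuous_fnorm; apply: mx_continuousB => //; apply: mx_continuous_cst.
  exact: continuous_penalty fc1 fc2.
have [Q Q1 Qmin] := orthogonal_min fc.
exists Q => //; set B := Q^T *m A *m Q.
have Q1e : a * fnorm (Q - 1%:M) < a * e' / (2 * fnorm A + 1).
  apply: le_lt_trans TA; rewrite -[leRHS]fnormN opprB.
  apply: le_trans (fnorm_mxmask N _).
  have := Qmin 1%:M; rewrite /f trmx1 !mulmx1 mul1mx subrr fnorm0 mulr0 addr0.
  by move=> /(_ erefl); apply: le_trans; rewrite lerDr fnorm_ge0.
have BA : fnorm (B - A) < e'.
  have -> : B - A = (Q - 1%:M)^T *m (A *m Q) + A *m (Q - 1%:M).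
    by rewrite linearB /= trmx1 mulmxBl mul1mx mulmxBr mulmx1 mulmxA addrA subrK.
  apply: le_lt_trans (fnormD _ _) _.
  have := fnormM (Q - 1%:M)^T (A *m Q); rewrite fnorm_tr.
  rewrite (fnorm_unitaryr A Q1); have := fnormM A (Q - 1%:M).
  move: Q1e; rewrite -mulrA ltr_pM2l // ltr_pdivlMr //.
  have := fnorm_ge0 (Q - 1%:M).
  lra.
have Bsym : B^T = B by rewrite /B !trmx_mul trmxK Asym mulmxA.
split; first by apply: lt_le_trans BA _; rewrite ge_min lexx.
apply/eqP; rewrite -subr_eq0 -linearB /=; apply: contraT => r0.
have slope : 2 * a * fnorm (mxmask N (B - T)) <= fnorm (comm B (mxmask N (B - T))).
  have -> : 2 * a = c / 2 by rewrite /a; field.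
  apply: (lower_bound_near lb); last exact: mxmaskK.
    by apply: le_trans (ltW BA) _; rewrite ge_min lexx orbT.
  by rewrite mxmask_tr // linearB /= Bsym Tsym.
have [U U1] := isospectral_descent Nsym Bsym Tsym a0 r0 slope.
have QU1 : (Q *m U)^T *m (Q *m U) = 1%:M.
  by rewrite trmx_mul -mulmxA (mulmxA _ Q) Q1 mul1mx.
have := Qmin _ QU1; rewrite /f trmx_mul.
have -> : U^T *m Q^T *m A *m (Q *m U) = U^T *m B *m U by rewrite !mulmxA.
rewrite -/B.
have : fnorm (Q *m U - 1%:M) <= fnorm (Q - 1%:M) + fnorm (U - 1%:M).
  have -> : Q *m U - 1%:M = Q *m (U - 1%:M) + (Q - 1%:M).
    by rewrite mulmxBr mulmx1 addrA subrK.
  by rewrite addrC; apply: le_trans (fnormD _ _) _; rewrite fnorm_unitaryl.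
move=> /(ler_wpM2l (ltW a0)); lra.
Qed.

End Perturbation.

(** * Graphs and the liberation of edges *)

Section Patterns.
Variables (R : realType) (n : nat).
Implicit Types (K : sgraph 'I_n) (A X : 'M[R]_n) (beta : {set {set 'I_n}}).

Definition nonedge K : rel 'I_n :=
  fun i j => (i != j) && ([set i; j] \notin edges K).

Lemma nonedge_sym K : symmetric (nonedge K).
Proof. by move=> i j; rewrite /nonedge eq_sym setUC. Qed.

Lemma mem_compl K i j : ([set i; j] \in edges (compl K)) = nonedge K i j.
Proof. by rewrite inE cards2 /nonedge; case: (i != j). Qed.

Lemma in_S0cl_compl K X :
  in_S0cl (compl K) X <-> X^T = X /\ mxmask (nonedge K) X = X.
Proof.
split=> [[Xsym _ Xcl]|[Xsym Xmask]].
  split=> //; apply/matrixP => i j; rewrite mxE -mem_compl.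
  by case: ifPn => // /negP Nij; apply/esym/eqP; apply: contra_notT Nij => /Xcl.
split=> // [i|i j]; first by rewrite -Xmask mxE /nonedge eqxx.
by rewrite -Xmask mxE mem_compl; case: ifP => // _; rewrite eqxx.
Qed.

Lemma has_SSP_wrtE K A : has_SSP_wrt K A <-> SSP_pattern (nonedge K) A.
Proof.
split=> sA X => [Xsym Xmask|/in_S0cl_compl[Xsym Xmask]]; last exact: sA.
by apply: sA; apply/in_S0cl_compl.
Qed.

Lemma has_SSP_wrt_sub K K' A :
  edges K \subset edges K' -> has_SSP_wrt K A -> has_SSP_wrt K' A.
Proof.
move=> /subsetP sKK' sA X [Xsym X0 Xcl]; apply: sA; split=> // i j /Xcl.
by rewrite !mem_compl => /andP[ij]; rewrite /nonedge ij; apply: contra; apply: sKK'.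
Qed.

Lemma add_edges_sub K beta beta' : beta' \subset beta ->
  edges (add_edges K beta') \subset edges (add_edges K beta).
Proof. by move=> s; rewrite setUS // setSI. Qed.

Lemma uniform_radius (I : finType) (P : I -> 'M[R]_n -> Prop) A :
  (forall i, exists2 e : R, 0 < e & forall B, fnorm (B - A) < e -> P i B) ->
  exists2 e : R, 0 < e & forall B, fnorm (B - A) < e -> forall i, P i B.
Proof.
move=> Pe.
suff [e e0 He] : exists2 e : R, 0 < e
    & forall B, fnorm (B - A) < e -> forall i, i \in enum I -> P i B.
  by exists e => // B /He Hi i; apply: Hi; rewrite mem_enum.
elim: (enum I) => [|i s [e e0 IH]]; first by exists 1.
have [e' e'0 Pi] := Pe i; exists (Num.min e e') => [|B].
  by rewrite lt_min e0.
rewrite lt_min => /andP[/IH Bs /Pi Bi] j; rewrite inE => /orP[/eqP->//|].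
exact: Bs.
Qed.

Section Liberation.
Variables (G : sgraph 'I_n) (A : 'M[R]_n) (beta : {set {set 'I_n}}).
Hypothesis lib : SSP_liberation_set G A beta.

(** What is preserved while the entries of beta become nonzero one after the
    other.  The SSP is kept for beta minus each of its edges, as any of them may
    be the next one to be treated. *)
Record partly_liberated (C : 'M[R]_n) : Prop := {
  pl_sym : C^T = C;
  pl_isospectral : exists2 Q : 'M[R]_n, Q^T *m Q = 1%:M & C = Q^T *m A *m Q;
  pl_nonedge : forall i j, nonedge (add_edges G beta) i j -> C i j = 0;
  pl_edge : forall i j, i != j -> [set i; j] \in edges G -> C i j != 0;
  pl_SSP : forall e, e \in beta -> has_SSP_wrt (add_edges G (beta :\ e)) C }.

Definition beta_zeros (C : 'M[R]_n) :=
  [set p : 'I_n * 'I_n | ([set p.1; p.2] \in beta) && (C p.1 p.2 == 0)].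

Let beta_nonedge i j : [set i; j] \in beta -> nonedge G i j.
Proof.
by case: lib => _ _ /subsetP sb _ /sb; rewrite mem_compl.
Qed.

Let mem_add_edges (b : {set {set 'I_n}}) i j : b \subset beta ->
  ([set i; j] \in edges (add_edges G b))
  = ([set i; j] \in edges G) || ([set i; j] \in b).
Proof.
move=> /subsetP sb; rewrite /= in_setU in_setI mem_compl; congr (_ || _).
by case: (boolP (_ \in b)) => // /sb/beta_nonedge ->.
Qed.

Lemma partly_liberated_self : partly_liberated A.
Proof.
have [[Asym AG] b0 sb sA] := lib; split=> //.
- by exists 1%:M; rewrite ?trmx1 ?mul1mx ?mulmx1.
- move=> i j /andP[ij]; rewrite mem_add_edges // => /norP[Gij _].
  by apply/eqP; rewrite -[_ == _]negbK AG.
- by move=> i j ij; rewrite AG.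
- by move=> e eb; apply: sA; rewrite ?subD1set // (cardsD1 e beta) eb subn1.
Qed.

(** An entry e of beta is zero.  Prescribing the nonedges of G + beta minus e,
    which are the nonedges of G + beta and e itself, gives e a nonzero value t
    and leaves zeros at the nonedges of G + beta. *)
Lemma liberation_step C : partly_liberated C -> beta_zeros C != set0 ->
  exists2 C', partly_liberated C' & beta_zeros C' \proper beta_zeros C.
Proof.
move=> [Csym [Q Q1 CE] Cnon Cedge Cstrong] /set0Pn[[i j]].
rewrite inE /= => /andP[ijb /eqP Cij].
set e := [set i; j] in ijb; have /andP[ij eG] := beta_nonedge ijb.
have [r1 r10 Hstrong] : exists2 r : R, 0 < r & forall B, fnorm (B - C) < r ->
    forall f, f \in beta -> has_SSP_wrt (add_edges G (beta :\ f)) B.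
  apply: uniform_radius => f; have [fb|_] := boolP (f \in beta); last by exists 1.
  have /has_SSP_wrtE/SSP_pattern_open[r r0 Hr] := Cstrong f fb.
  by exists r => // B /Hr /has_SSP_wrtE.
have [r2 r20 Hnz] : exists2 r : R, 0 < r & forall B, fnorm (B - C) < r ->
    forall p : 'I_n * 'I_n, C p.1 p.2 != 0 -> B p.1 p.2 != 0.
  apply: (uniform_radius (P := fun p B => C p.1 p.2 != 0 -> B p.1 p.2 != 0)).
  move=> -[a b]; have [Cab|Cab] := eqVneq (C a b) 0.
    by exists 1 => // B _; rewrite /= Cab eqxx.
  exists `|C a b| => [|B BC _]; first by rewrite normr_gt0.
  apply: contraTneq BC => /= Bab; rewrite -leNgt.
  by have := entry_le_fnorm (B - C) a b; rewrite !mxE Bab sub0r normrN.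
pose N := nonedge (add_edges G (beta :\ e)).
have r0 : 0 < Num.min r1 r2 by rewrite lt_min r10.
have /has_SSP_wrtE CN := Cstrong e ijb.
have [d d0 Hd] := isospectral_prescription (nonedge_sym _) Csym CN r0.
(* The target T is C with a small symmetric perturbation at e. *)
pose M : 'M[R]_n := delta_mx i j + delta_mx j i.
pose t := d / (fnorm M + 1); pose T := C + t *: M.
have M1 : 0 < fnorm M + 1 by rewrite ltr_wpDl ?fnorm_ge0.
have t0 : 0 < t by rewrite divr_gt0.
have Tsym : T^T = T.
  by rewrite /T linearD linearZ /= Csym /M linearD /= !trmx_delta (addrC (delta_mx j i)).
have TC : fnorm (T - C) < d.
  rewrite /T addrC addKr fnormZ gtr0_norm // /t mulrAC.
  by rewrite ltr_pdivrMr // ltr_pM2l // ltrDl.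
have [U U1 []] := Hd T Tsym TC.
set C' := U^T *m C *m U; rewrite lt_min => /andP[C'C1 C'C2] C'T.
have C'E a b : N a b -> C' a b = T a b.
  by move=> Nab; have /matrixP/(_ a b) := C'T; rewrite mxE [RHS]mxE -/(N a b) Nab.
exists C'.
  split.
  - by rewrite /C' !trmx_mul trmxK Csym mulmxA.
  - exists (Q *m U); last by rewrite /C' CE trmx_mul !mulmxA.
    by rewrite trmx_mul -mulmxA (mulmxA _ Q) Q1 mul1mx.
  (* At a nonedge of G + beta, which is not e, the target agrees with C. *)
  - move=> a b Nab; rewrite C'E.
      have /andP[ab] := Nab; rewrite mem_add_edges // => /norP[_ abb].
      rewrite !mxE (Cnon _ _ Nab) add0r.
      have [|_] := boolP ((a == i) && (b == j)).
        by case/andP => /eqP ai /eqP bj; rewrite ai bj ijb in abb.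
      have [|_] := boolP ((a == j) && (b == i)).
        by case/andP => /eqP ai /eqP bj; rewrite ai bj setUC ijb in abb.
      by rewrite addr0 mulr0.
    move: Nab; rewrite /N /nonedge => /andP[-> /=]; apply: contra.
    by apply/subsetP/add_edges_sub/subD1set.
  - by move=> a b ab /(Cedge _ _ ab); apply: (Hnz _ C'C2 (a, b)).
  - exact: Hstrong.
apply/properP; split.
  apply/subsetP => -[a b]; rewrite !inE /= => /andP[-> /eqP C'ab] /=.
  by apply: contraTT isT => /(Hnz _ C'C2 (a, b)) /=; rewrite C'ab eqxx.
exists (i, j); rewrite !inE /= ijb ?Cij ?eqxx //= C'E.
  by rewrite !mxE Cij !eqxx (negPf ij) /= add0r addr0 mulr1 gt_eqF.
by rewrite /N /nonedge ij mem_add_edges ?subD1set // !inE eqxx orbF.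
Qed.

(** The number of zero entries at beta decreases until none is left; then the
    SSP with respect to G + beta follows from that with respect to a smaller
    graph, one edge of beta less. *)
Lemma liberation : exists C,
  [/\ in_S (add_edges G beta) C, has_SSP (add_edges G beta) C
    & exists2 Q : 'M[R]_n, Q^T *m Q = 1%:M & C = Q^T *m A *m Q].
Proof.
have [C Clib C0] : exists2 C, partly_liberated C & beta_zeros C = set0.
  have [k] := ubnP #|beta_zeros A|; move: partly_liberated_self.
  elim: k A => // k IH C Clib zC.
  have [z0|/(liberation_step Clib)[C' C'lib zC']] := eqVneq (beta_zeros C) set0.
    by exists C.
  by apply: IH C'lib _; apply: leq_trans (proper_card zC') _.
have [Csym Ciso Cnon Cedge Cstrong] := Clib.
exists C; split=> //.
  split=> // i j ij; rewrite mem_add_edges //.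
  have [Gij|GNij] /= := boolP (_ \in edges G); first exact: Cedge.
  have [bij|bNij] := boolP (_ \in beta).
    have /setP/(_ (i, j)) := C0; rewrite !inE /= bij /= => ->.
    by [].
  apply/negbTE; rewrite negbK Cnon // /nonedge ij mem_add_edges //.
  by rewrite negb_or GNij.
have [_ /set0Pn[e eb] _ _] := lib.
by apply: has_SSP_wrt_sub (Cstrong e eb); apply/add_edges_sub/subD1set.
Qed.

End Liberation.
End Patterns.

(** * Direct sums *)

Section DisjointUnion.
Variables (n m : nat) (G : sgraph 'I_n) (H : sgraph 'I_m).

Lemma dunion_ll i j :
  ([set lshift m i; lshift m j] \in edges (dunion G H))
  = ([set i; j] \in edges G).
Proof.
have -> : [set lshift m i; lshift m j] = lshift m @: [set i; j].
  by rewrite imsetU !imset_set1.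
rewrite inE mem_imset; last exact/imset_inj/lshift_inj.
rewrite orbC; case: imsetP => // -[f _ /setP/(_ (lshift m i))].
rewrite mem_imset ?inE ?eqxx; last exact: lshift_inj.
by move/esym/imsetP => [x _ /eqP]; rewrite eq_lrshift.
Qed.

Lemma dunion_rr i j :
  ([set rshift n i; rshift n j] \in edges (dunion G H))
  = ([set i; j] \in edges H).
Proof.
have -> : [set rshift n i; rshift n j] = @rshift n m @: [set i; j].
  by rewrite imsetU !imset_set1.
rewrite inE (mem_imset (f := fun f : {set 'I_m} => _ @: f)); last exact/imset_inj/rshift_inj.
case: imsetP => // -[f _ /setP/(_ (rshift n i))].
rewrite mem_imset ?inE ?eqxx; last exact: rshift_inj.
by move/esym/imsetP => [x _ /eqP]; rewrite eq_rlshift.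
Qed.

Lemma dunion_lr i j : [set lshift m i; rshift n j] \notin edges (dunion G H).
Proof.
rewrite inE negb_or; apply/andP; split; apply/imsetP => -[f _ /setP E].
  have /esym := E (rshift n j); rewrite !inE eqxx orbT.
  by move/imsetP => [x _ /eqP]; rewrite eq_rlshift.
have /esym := E (lshift m i); rewrite !inE eqxx.
by move/imsetP => [x _ /eqP]; rewrite eq_lrshift.
Qed.

Lemma set_lr_inj i j i' j' :
  [set lshift m i; rshift n j] = [set lshift m i'; rshift n j'] ->
  i = i' /\ j = j'.
Proof.
move/setP => E; split.
  have := E (lshift m i); rewrite !inE eqxx !eq_lrshift !orbF.
  by move/esym/eqP/lshift_inj.
have := E (rshift n j); rewrite !inE eqxx !eq_rlshift /=.
by move/esym/eqP/rshift_inj.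
Qed.

Lemma cross_edges_lr (VG : {set 'I_n}) (VH : {set 'I_m}) i j :
  ([set lshift m i; rshift n j] \in cross_edges VG VH)
  = (i \in VG) && (j \in VH).
Proof.
apply/imset2P/andP => [[u v uV vV /set_lr_inj[-> ->]] //|[iV jV]].
by exists i j.
Qed.

Lemma cross_edges_sub VG VH :
  cross_edges VG VH \subset edges (compl (dunion G H)).
Proof.
apply/subsetP => _ /imset2P[u v _ _ ->].
by rewrite inE dunion_lr andbT cards2 eq_lrshift.
Qed.

Lemma in_S_dsum (R : realType) (A : 'M[R]_n) (B : 'M[R]_m) :
  in_S G A -> in_S H B -> in_S (dunion G H) (block_mx A 0 0 B).
Proof.
move=> [Asym AG] [Bsym BH]; split; first by rewrite tr_block_mx Asym Bsym !trmx0.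
move=> i j; case: (split_ordP i) => {}i ->; case: (split_ordP j) => {}j ->.
- by rewrite (inj_eq (@lshift_inj _ _)) block_mxEul dunion_ll; apply: AG.
- by rewrite block_mxEur mxE eqxx (negPf (dunion_lr _ _)).
- by rewrite block_mxEdl mxE eqxx setUC (negPf (dunion_lr _ _)).
- by rewrite (inj_eq (@rshift_inj _ _)) block_mxEdr dunion_rr; apply: BH.
Qed.

End DisjointUnion.

Lemma subset_card_pred (T : finType) (X Y : {set T}) :
  X != set0 -> Y \subset X -> #|Y| = (#|X| - 1)%N ->
  exists2 e, e \in X & Y = X :\ e.
Proof.
move=> X0 YX cY; have /cards1P[e De] : #|X :\: Y| == 1%N.
  by rewrite cardsD (setIidPr YX) cY subKn // card_gt0.
exists e; first by have := set11 e; rewrite -De => /setDP[].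
by rewrite -De setDDr setDv set0U (setIidPr YX).
Qed.

Section DirectSum.
Variables (R : realType) (n m : nat) (G : sgraph 'I_n) (H : sgraph 'I_m).
Variables (A : 'M[R]_n) (B : 'M[R]_m) (lambda : R).
Hypotheses (hA : in_S G A) (hB : in_S H B).
Hypotheses (sspA : has_SSP G A) (sspB : has_SSP H B).
Hypothesis common :
  forall x, (0 < spec A x)%N -> (0 < spec B x)%N -> x = lambda.
Hypotheses (genA : generic (ker (A - lambda%:M)))
           (genB : generic (ker (B - lambda%:M))).

(** Each row of Y indexed by VG is in ker (B - lambda) and vanishes on VH, so it
    is zero; each column of Y is then a vector of ker (A - lambda) that vanishes
    on VG, so it is zero as well. *)
Lemma intertwiner_zero_block (VG : {set 'I_n}) (VH : {set 'I_m})
    (Y : 'M[R]_(n, m)) :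
  (spec A lambda <= #|VG|)%N -> (spec B lambda <= #|VH|)%N ->
  A *m Y = Y *m B -> (forall i j, i \in VG -> j \in VH -> Y i j = 0) -> Y = 0.
Proof.
have [[Asym _] [Bsym _]] := (hA, hB).
move=> cG cH AY Y0.
have kerA := intertwiner_eigenspace Asym Bsym common AY.
have kerB : (B - lambda%:M) *m Y^T = 0.
  apply: (intertwiner_eigenspace (B := A)) => //.
    by move=> x Bx Ax; apply: common.
  by rewrite -{1}Bsym -{1}Asym -!trmx_mul AY.
have Yrow i : i \in VG -> forall j, Y i j = 0.
  move=> iV j; suff /matrixP/(_ j 0) : col i Y^T = 0 by rewrite !mxE.
  apply: (generic_eq0 (V := VH) genB).
  - exact: leq_trans (dim_eigenspace_le _ Bsym) cH.
  - by rewrite memv_mxker colE mulmxA kerB mul0mx.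
  - by move=> k kV; rewrite !mxE Y0.
apply/matrixP => i j; suff /matrixP/(_ i 0) : col j Y = 0 by rewrite !mxE.
apply: (generic_eq0 (V := VG) genA).
- exact: leq_trans (dim_eigenspace_le _ Asym) cG.
- by rewrite memv_mxker colE mulmxA kerA mul0mx.
- by move=> k kV; rewrite mxE Yrow.
Qed.

(** The blocks of the equation for X decouple: the diagonal ones are governed by
    the SSP of A and of B, the off-diagonal one says that it intertwines A
    and B, and vanishes on VG x VH. *)
Lemma dsum_SSP_wrt (beta : {set {set 'I_(n + m)}}) (VG : {set 'I_n})
    (VH : {set 'I_m}) :
  (spec A lambda <= #|VG|)%N -> (spec B lambda <= #|VH|)%N ->
  cross_edges VG VH \subset beta ->
  has_SSP_wrt (add_edges (dunion G H) beta) (block_mx A 0 0 B).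
Proof.
move=> cG cH sb X [Xsym X0 Xcl].
rewrite -[X]submxK mulmx_block mulmx_block !mul0mx !mulmx0 !add0r !addr0.
rewrite opp_block_mx add_block_mx => /eqP.
rewrite block_mx_eq0 => /and4P[/eqP E1 /eqP E2 _ /eqP E4].
have Xnon i j : X i j != 0 -> [set i; j] \notin edges (dunion G H).
  move=> /Xcl; rewrite mem_compl => /andP[_].
  by rewrite inE => /norP[].
have ul : ulsubmx X = 0.
  apply: sspA E1; split.
  - by rewrite trmx_ulsub Xsym.
  - by move=> i; rewrite !mxE X0.
  - move=> i j; rewrite !mxE => Xij; rewrite mem_compl /nonedge.
    rewrite -(dunion_ll _ H) Xnon // andbT.
    by apply: contra_neq Xij => ->; rewrite X0.
have dr : drsubmx X = 0.
  apply: sspB E4; split.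
  - by rewrite trmx_drsub Xsym.
  - by move=> i; rewrite !mxE X0.
  - move=> i j; rewrite !mxE => Xij; rewrite mem_compl /nonedge.
    rewrite -(dunion_rr G) Xnon // andbT.
    by apply: contra_neq Xij => ->; rewrite X0.
have ur : ursubmx X = 0.
  apply: (intertwiner_zero_block cG cH) => [|i j iV jV].
    by apply/eqP; rewrite -subr_eq0 E2.
  rewrite !mxE; apply/eqP; apply: contraT => /Xcl; rewrite mem_compl => /andP[_].
  have ijb : [set lshift m i; rshift n j] \in cross_edges VG VH.
    by rewrite cross_edges_lr iV.
  by rewrite !in_setU in_setI (subsetP sb) // (subsetP (cross_edges_sub G H VG VH)) // orbT.
have dl : dlsubmx X = 0 by rewrite -[dlsubmx X]trmxK trmx_dlsub Xsym ur trmx0.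
by rewrite ul dr ur dl block_mx0.
Qed.

End DirectSum.

Theorem theorem3p5 (R : realType) (n m : nat)
    (G : sgraph 'I_n) (H : sgraph 'I_m) (A : 'M[R]_n) (B : 'M[R]_m)
    (lambda : R) (k l : nat)
    (hA : in_S G A) (hB : in_S H B)
    (sspA : has_SSP G A) (sspB : has_SSP H B)
    (common : forall x : R, ((0 < spec A x)%N /\ (0 < spec B x)%N) <-> x = lambda)
    (multA : spec A lambda = k) (multB : spec B lambda = l)
    (genA : generic (ker (A - lambda%:M)))
    (genB : generic (ker (B - lambda%:M)))
    (VG : {set 'I_n}) (VH : {set 'I_m})
    (hcard : (#|VG| = k /\ #|VH| = l.+1) \/ (#|VG| = k.+1 /\ #|VH| = l)) :
  SSP_liberation_set (dunion G H) (block_mx A 0 0 B) (cross_edges VG VH) /\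
  exists C : 'M[R]_(n + m),
    [/\ in_S (add_edges (dunion G H) (cross_edges VG VH)) C,
        has_SSP (add_edges (dunion G H) (cross_edges VG VH)) C
      & forall x : R, spec C x = (spec A x + spec B x)%N].
Proof.
have [Ak Bl] : (0 < spec A lambda)%N /\ (0 < spec B lambda)%N by apply/common.
have {}common x : (0 < spec A x)%N -> (0 < spec B x)%N -> x = lambda.
  by move=> Ax Bx; apply/common.
have lib : SSP_liberation_set (dunion G H) (block_mx A 0 0 B) (cross_edges VG VH).
  have beta0 : cross_edges VG VH != set0 :> {set {set 'I_(n + m)}}.
    have [[u uV] [v vV]] : (exists u, u \in VG) /\ (exists v, v \in VH).
      by split; apply/card_gt0P; case: hcard => -[cG cH]; rewrite ?cG ?cH -?multA -?multB.
    by apply/set0Pn; exists [set lshift m u; rshift n v]; rewrite cross_edges_lr uV.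
  split=> //; [exact: in_S_dsum|exact: cross_edges_sub|].
  move=> beta' sb /(subset_card_pred beta0 sb)[_ /imset2P[u v uV vV ->] ->].
  (* The removed edge u v is dropped by deleting its end on the larger side. *)
  case: hcard => -[cG cH].
    apply: (dsum_SSP_wrt hA hB sspA sspB common genA genB (VG := VG) (VH := VH :\ v)).
    - by rewrite cG multA.
    - by rewrite multB -ltnS -cH (cardsD1 v VH) vV.
    - apply/subsetP => _ /imset2P[a b aV /setD1P[bv bV] ->].
      rewrite in_setD1 cross_edges_lr aV bV !andbT.
      by apply: contra_neq bv => /set_lr_inj[].
  apply: (dsum_SSP_wrt hA hB sspA sspB common genA genB (VG := VG :\ u) (VH := VH)).
  - by rewrite multA -ltnS -cG (cardsD1 u VG) uV.
  - by rewrite cH multB.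
  - apply/subsetP => _ /imset2P[a b /setD1P[au aV] bV ->].
    rewrite in_setD1 cross_edges_lr aV bV !andbT.
    by apply: contra_neq au => /set_lr_inj[].
split=> //; have [C [CS Cssp [Q Q1 CE]]] := liberation lib.
exists C; split=> // x; rewrite -spec_dsum /spec.
congr mup; apply: (@char_poly_similar _ _ _ _ Q); first by have [] := mulmx1_unit Q1.
by rewrite CE !mulmxA (mulmx1C Q1) mul1mx.
Qed.
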